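(* Let $2\le k<n$ be integers, let $G=([n],E,w)$ be a weighted graph with real edge weights, and let $F=[f_1,\dots,f_n]\in\mathbb{R}^{r\times n}$ be a feature matrix associated with $G$. Suppose there exists a perfect feature balanced partition $\{A_1,A_2,\dots,A_k\}$ of $[n]$, i.e. a partition with $$\sum_{i\in A_1}f_i=\sum_{i\in A_2}f_i=\cdots=\sum_{i\in A_k}f_i.$$ Then the Max-$k$-Cut SDP on $G$ is exact.
   Context: $[n]=\{1,\dots,n\}$; $\mathbb{S}^n$ is the space of real symmetric $n\times n$ matrices; $X\succeq0$ means positive semidefinite. A matrix $F=[f_1,\dots,f_n]\in\mathbb{R}^{r\times n}$ is a feature matrix associated with $G$ if its columns satisfy $w_{ij}=f_i^\top f_j$ for every $i\ne j$ (with $w_{ij}=0$ if $ij\notin E$). Max-$k$-Cut on $G$: partition $[n]$ into $k$ disjoint (possibly empty) parts $A_1,\dots,A_k$ so as to maximize $\operatorname{Cut}(A_1,\dots,A_k)=\sum_{\ell<m}\sum_{i\in A_\ell,\,j\in A_m}w_{ij}$. The Max-$k$-Cut SDP (Frieze--Jerrum relaxation) on $G$ is to maximize $\frac{k-1}{k}\sum_{i<j}w_{ij}(1-X_{ij})$ over $X\in\mathbb{S}^n$ subject to $X_{ii}=1$ for all $i$, $X_{ij}\ge-\frac{1}{k-1}$ for all $i\ne j$, and $X\succeq0$. The SDP is exact on $G$ if its optimal value equals the optimal value of Max-$k$-Cut on $G$. *)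

(* Defs.v *)
From mathcomp Require Import all_boot all_order all_algebra.
From mathcomp Require Import boolp classical_sets reals ereal.

Set Implicit Arguments.
Unset Strict Implicit.
Unset Printing Implicit Defensive.

Import Order.TTheory GRing.Theory Num.Theory.

Local Open Scope ring_scope.

(* Vertices 1, ..., n are represented by the ordinals 0, ..., n - 1. Weights of
   edges are arbitrary reals (possibly zero or negative). *)
Record wgraph (R : realType) (n : nat) := WGraph {
  edge : rel 'I_n;
  weight : 'I_n -> 'I_n -> R;
  edge_sym : symmetric edge;
  edge_irr : irreflexive edge;
  weight_sym : forall i j, weight i j = weight j i;
  weight_nonedge : forall i j, ~~ edge i j -> weight i j = 0
}.

Definition is_feature_matrix (R : realType) (n r : nat)
    (G : wgraph R n) (F : 'M[R]_(r, n)) : Prop :=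
  forall i j : 'I_n, i != j ->
    weight G i j = ((col i F)^T *m col j F) 0 0.

(* Unlike finset's [partition], the parts are indexed and may be empty. *)
Definition is_kpartition (k n : nat) (A : 'I_k -> {set 'I_n}) : Prop :=
  (forall l m : 'I_k, l != m -> [disjoint A l & A m]) /\
  (\bigcup_(l < k) A l)%SET = [set: 'I_n]%SET.

Definition perfect_feature_balanced (R : realType) (k n r : nat)
    (F : 'M[R]_(r, n)) (A : 'I_k -> {set 'I_n}) : Prop :=
  is_kpartition A /\
  forall l m : 'I_k, \sum_(i in A l) col i F = \sum_(i in A m) col i F.

Definition cut (R : realType) (k n : nat)
    (G : wgraph R n) (A : 'I_k -> {set 'I_n}) : R :=
  \sum_(l < k) \sum_(m < k | (l < m)%N)
    \sum_(i in A l) \sum_(j in A m) weight G i j.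

Definition psd (R : realType) (n : nat) (X : 'M[R]_n) : Prop :=
  X^T = X /\ forall x : 'cV[R]_n, 0 <= (x^T *m X *m x) 0 0.

Definition sdp_feasible (R : realType) (k n : nat) (X : 'M[R]_n) : Prop :=
  [/\ forall i : 'I_n, X i i = 1,
      forall i j : 'I_n, i != j -> - (k%:R - 1)^-1 <= X i j
    & psd X].

Definition sdp_obj (R : realType) (k n : nat)
    (G : wgraph R n) (X : 'M[R]_n) : R :=
  (k%:R - 1) / k%:R *
    \sum_(i < n) \sum_(j < n | (i < j)%N) weight G i j * (1 - X i j).

Local Open Scope classical_set_scope.

(* Optimal values are suprema in the extended reals, so that no default value
   is involved for empty or unbounded problems. *)
Definition maxkcut_value (R : realType) (k n : nat) (G : wgraph R n) : \bar R :=
  ereal_sup [set (cut G A)%:E | A in [set A : 'I_k -> {set 'I_n} | is_kpartition A]].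

Definition sdp_value (R : realType) (k n : nat) (G : wgraph R n) : \bar R :=
  ereal_sup [set (sdp_obj k G X)%:E | X in [set X : 'M[R]_n | sdp_feasible k X]].

Definition sdp_exact (R : realType) (k n : nat) (G : wgraph R n) : Prop :=
  sdp_value k G = maxkcut_value k G.

(* Main.v *)
Require Import Defs.
From mathcomp Require Import all_boot all_order all_algebra.
From mathcomp Require Import boolp classical_sets reals ereal.
From mathcomp Require Import ring.

(** A partition with labels [p] is encoded by the matrix [X_p] with entries [1]
    inside the parts and [-1/(k-1)] across them; it is a scaled Gram matrix
    [k/(k-1) V^T V], hence feasible, and its objective value is the cut.
    When [diag X = 1], the objective at [X] equals
    [(k-1)/(2k) (|sum_i f_i|^2 - tr (F X F^T))], and the trace is nonnegative
    for [X] positive semidefinite.  For a balanced partition [F V^T = 0], so the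
    trace vanishes and [X_p] is optimal. *)

Set Implicit Arguments.
Unset Strict Implicit.
Unset Printing Implicit Defensive.

Import Order.TTheory GRing.Theory Num.Theory.

Local Open Scope ring_scope.

Lemma sum_ltn_sym (V : nmodType) (n : nat) (f : 'I_n -> 'I_n -> V) :
    (forall i j, f i j = f j i) ->
  (\sum_(i < n) \sum_(j < n | (i < j)%N) f i j) *+ 2
    = \sum_(i < n) \sum_(j < n | j != i) f i j.
Proof.
move=> f_sym; rewrite mulr2n.
have {2}-> : \sum_(i < n) \sum_(j < n | (i < j)%N) f i j
    = \sum_(i < n) \sum_(j < n | (j < i)%N) f i j.
  rewrite (exchange_big_dep predT) //=.
  by apply: eq_bigr => i _; apply: eq_bigr => j _; rewrite f_sym.
rewrite -big_split /=; apply: eq_bigr => i _.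
rewrite [RHS](bigID (fun j : 'I_n => (i < j)%N)) /=.
by congr (_ + _); apply: eq_bigl => j; rewrite -val_eqE /=; case: ltngtP.
Qed.

(** Covering gives each vertex a label and disjointness makes it unique, so membership in a part
    becomes an equality of labels. *)
Lemma kpartition_label (k n : nat) (A : 'I_k -> {set 'I_n}) :
  is_kpartition A -> exists p : 'I_n -> 'I_k, forall i l, (i \in A l) = (p i == l).
Proof.
move=> [A_disj A_cover].
have /choice[p pP] : forall i, exists l, i \in A l.
  move=> i; have: i \in (\bigcup_(l < k) A l)%SET by rewrite A_cover inE.
  by case/bigcupP => l _ il; exists l.
exists p => i l; apply/idP/eqP => [il|<- //].
apply/eqP/negP => /negP /A_disj /disjoint_setI0 /setP /(_ i).
by rewrite !inE pP il.
Qed.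

Section Simplex.
Variables (R : realType) (k n : nat) (p : 'I_n -> 'I_k).
Hypothesis hk : (2 <= k)%N.

(* Column [i] is the vertex [e_(p i)] of the standard simplex, recentred at the
   barycentre. *)
Definition simplex_mx : 'M[R]_(k, n) := \matrix_(l, i) ((p i == l)%:R - k%:R^-1).

Definition partition_mx : 'M[R]_n :=
  (k%:R / (k%:R - 1)) *: (simplex_mx^T *m simplex_mx).

Let k_neq0 : k%:R != 0 :> R.
Proof. by rewrite pnatr_eq0 -lt0n ltnW. Qed.

Let k1_gt0 : 0 < k%:R - 1 :> R.
Proof. by rewrite subr_gt0 ltr1n. Qed.

(** Recentred vertices with labels [a] and [b] have inner product [[a = b] - 1/k]; the factor
    [k/(k-1)] brings the diagonal to [1]. *)
Lemma partition_mxE i j :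
  partition_mx i j = if p i == p j then 1 else - (k%:R - 1)^-1.
Proof.
have k1_neq0 := lt0r_neq0 k1_gt0.
have sum_label (h : 'I_k -> R) m : \sum_l (m == l)%:R * h l = h m.
  rewrite (bigD1 m) //= eqxx mul1r big1 ?addr0 // => l /negbTE.
  by rewrite eq_sym => ->; rewrite mul0r.
have -> : partition_mx i j = k%:R / (k%:R - 1) * ((p i == p j)%:R - k%:R^-1).
  rewrite !mxE; congr (_ * _).
  under eq_bigr => l _ do rewrite !mxE mulrBl.
  rewrite sumrB sum_label -mulr_sumr sumrB.
  under [X in _ - _ * (X - _)]eq_bigr => l _ do rewrite -[_%:R]mulr1.
  rewrite (sum_label (fun=> 1)) sumr_const card_ord -[_^-1 *+ k]mulr_natl mulfV //.
  by rewrite subrr mulr0 subr0 eq_sym.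
by case: ifP => _ /=; field; rewrite k_neq0 k1_neq0.
Qed.

Lemma partition_mx_feasible : sdp_feasible k partition_mx.
Proof.
split=> [i|i j _|].
- by rewrite partition_mxE eqxx.
- rewrite partition_mxE; case: ifP => // _; apply: (le_trans _ ler01).
  by rewrite oppr_le0 invr_ge0 ltW.
split=> [|x]; first by rewrite linearZ /= trmx_mul trmxK.
rewrite -scalemxAr -scalemxAl mxE mulr_ge0 //.
  by rewrite divr_ge0 ?ler0n // ltW.
rewrite mulmxA -trmx_mul -mulmxA mxE sumr_ge0 // => l _.
by rewrite mxE -expr2 sqr_ge0.
Qed.

(** Pairs inside a part contribute [1 - 1 = 0]; across parts [1 + 1/(k-1) = k/(k-1)] cancels the
    prefactor of the objective. *)
Lemma cut_partition_mx (G : wgraph R n) (A : 'I_k -> {set 'I_n}) :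
  (forall i l, (i \in A l) = (p i == l)) -> cut G A = sdp_obj k G partition_mx.
Proof.
move=> pA; have k1_neq0 := lt0r_neq0 k1_gt0.
have w_sym := weight_sym G.
(* Doubling turns both sums, over [l < m] and over [i < j], into sums over ordered pairs, which can
   be regrouped by label. *)
apply: (@pmulrnI _ 2) => //.
rewrite /cut /sdp_obj sum_ltn_sym; last first.
  move=> l m; rewrite exchange_big /=.
  by apply: eq_bigr => i _; apply: eq_bigr => j _.
rewrite -mulrnAr sum_ltn_sym; last first.
  by move=> i j; rewrite w_sym !partition_mxE eq_sym.
transitivity (\sum_(i < n) \sum_(j < n | p j != p i) weight G i j).
  rewrite (partition_big p predT) //=; apply: eq_bigr => l _.
  rewrite exchange_big /=.
  apply: eq_big => [i|i]; rewrite pA // => /eqP pi.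
  rewrite [RHS](partition_big p (fun m => m != l)) /= => [|j]; last by rewrite pi.
  apply: eq_bigr => m ml; apply: eq_bigl => j; rewrite pA pi.
  by case: eqP => [->|]; rewrite ?ml ?andbF.
rewrite mulr_sumr; apply: eq_bigr => i _.
rewrite mulr_sumr big_mkcond [RHS]big_mkcond /=; apply: eq_bigr => j _.
rewrite partition_mxE [p i == _]eq_sym; case: (eqVneq j i) => [->|_].
  by rewrite eqxx.
by case: eqVneq => _ /=; [rewrite subrr !mulr0 | field; rewrite k_neq0 k1_neq0].
Qed.

(** Column [l] of the product is the feature sum of part [l] minus [1/k] times the total, and under
    balance the total is [k] times the common part sum. *)
Lemma balanced_simplex_mx (r : nat) (F : 'M[R]_(r, n)) (A : 'I_k -> {set 'I_n}) :
    (forall i l, (i \in A l) = (p i == l)) ->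
    (forall l m, \sum_(i in A l) col i F = \sum_(i in A m) col i F) ->
  F *m simplex_mx^T = 0.
Proof.
move=> pA bal; apply/matrixP => a l; rewrite !mxE.
have part_sum m : \sum_i F a i * (p i == m)%:R = (\sum_(i in A l) col i F) a 0.
  rewrite (bal l m) summxE [RHS]big_mkcond /=; apply: eq_bigr => i _.
  by rewrite mxE pA; case: eqP; rewrite ?mulr1 ?mulr0.
under eq_bigr => i _ do rewrite !mxE mulrBr.
rewrite sumrB part_sum -mulr_suml.
have -> : \sum_i F a i = k%:R * (\sum_(i in A l) col i F) a 0.
  transitivity (\sum_(m < k) \sum_i F a i * (p i == m)%:R).
    rewrite exchange_big /=; apply: eq_bigr => i _.
    rewrite (bigD1 (p i)) //= eqxx mulr1 big1 ?addr0 // => m.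
    by rewrite eq_sym => /negbTE ->; rewrite mulr0.
  by rewrite (eq_bigr _ (fun m _ => part_sum m)) sumr_const card_ord mulr_natl.
by rewrite mulrAC mulfV // mul1r subrr.
Qed.

End Simplex.

(** The weights fix only the off-diagonal entries of [F^T F]. Since [1 - X i i = 0], the diagonal
    terms can be added freely, which completes the double sum to a trace. *)
Lemma sdp_obj_feature (R : realType) (k n r : nat) (G : wgraph R n)
    (F : 'M[R]_(r, n)) (X : 'M[R]_n) :
    is_feature_matrix G F -> (forall i, X i i = 1) -> X^T = X ->
  sdp_obj k G X = (k%:R - 1) / k%:R *
    ((\sum_i \sum_j (F^T *m F) i j - \tr (F *m X *m F^T)) / 2).
Proof.
move=> hF X1 XT; rewrite /sdp_obj; congr (_ * _).
have X_sym i j : X i j = X j i by rewrite -[in LHS]XT mxE.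
apply: (@mulIf _ 2); rewrite ?pnatr_eq0 // mulfVK ?pnatr_eq0 // mulr_natr.
rewrite sum_ltn_sym => [|i j]; last by rewrite weight_sym X_sym.
have -> : \tr (F *m X *m F^T) = \sum_i \sum_j (F^T *m F) i j * X i j.
  rewrite mxtrace_mulC mulmxA; apply: eq_bigr => i _; rewrite mxE.
  by apply: eq_bigr => j _; rewrite X_sym.
rewrite -sumrB; apply: eq_bigr => i _.
rewrite -sumrB [RHS](bigD1 i) //= X1 mulr1 subrr add0r.
apply: eq_bigr => j ji; rewrite hF 1?eq_sym // mulrBr mulr1.
suff -> : ((col i F)^T *m col j F) 0 0 = (F^T *m F) i j by [].
by rewrite !mxE; apply: eq_bigr => a _; rewrite !mxE.
Qed.

(** Each diagonal entry of [F X F^T] is the quadratic form of [X] at a row of [F]. *)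
Lemma psd_mxtrace_ge0 (R : realType) (n r : nat) (F : 'M[R]_(r, n)) (X : 'M[R]_n) :
  psd X -> 0 <= \tr (F *m X *m F^T).
Proof.
move=> [_ X_ge0]; apply: sumr_ge0 => a _.
have := X_ge0 (row a F)^T; rewrite trmxK -row_mul.
suff -> : (row a (F *m X) *m (row a F)^T) 0 0 = (F *m X *m F^T) a a by [].
by rewrite [LHS]mxE [RHS]mxE; apply: eq_bigr => i _; rewrite ![_^T _ _]mxE ![row _ _ _ _]mxE.
Qed.

Theorem proposition6 (R : realType) (k n r : nat)
    (hk : (2 <= k)%N) (hkn : (k < n)%N)
    (G : wgraph R n) (F : 'M[R]_(r, n)) (hF : is_feature_matrix G F)
    (hA : exists A : 'I_k -> {set 'I_n}, perfect_feature_balanced F A) :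
  sdp_exact k G.
Proof.
apply/eqP; rewrite eq_le; apply/andP; split; apply: ge_ereal_sup.
(* The cut of the balanced partition bounds the objective at every feasible [X]: both values have
   the same first term, and only the trace at [X] is subtracted. *)
- move=> _ [X feasX <-]; have [X1 _ psdX] := feasX.
  have [A [partA balA]] := hA; have [p pA] := kpartition_label partA.
  have [Y1 _ psdY] := partition_mx_feasible R p hk.
  apply: (@le_trans _ _ (cut G A)%:E); last by apply: ereal_sup_ubound; exists A.
  rewrite lee_fin (cut_partition_mx hk G pA).
  rewrite (sdp_obj_feature k hF X1 psdX.1) (sdp_obj_feature k hF Y1 psdY.1).
  have -> : F *m partition_mx R p *m F^T = 0.
    by rewrite -scalemxAr mulmxA (balanced_simplex_mx hk pA balA) mul0mx scaler0 mul0mx.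
  rewrite ler_wpM2l ?divr_ge0 ?ler0n ?subr_ge0 ?ler1n 1?ltnW //.
  by rewrite ler_wpM2r ?invr_ge0 ?ler0n // mxtrace0 lerD2l lerN2 psd_mxtrace_ge0.
(* Conversely, every cut is the objective value of a feasible matrix. *)
- move=> _ [A partA <-]; have [p pA] := kpartition_label partA.
  apply: ereal_sup_ubound; exists (partition_mx R p).
    exact: partition_mx_feasible.
  by rewrite (cut_partition_mx hk G pA).
Qed.
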